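(* Let $(X,\mathscr{A},\mu,T)$ be a measure-preserving dynamical system on an infinite, $\sigma$-finite measure space, endowed with an exhaustive family $\mathscr{V}$, a space of global observables $\mathcal{G}$ and a space of local observables $\mathcal{L}$. Assume that one of the following two cases holds: (H1) $(X,\mathscr{A},\mu,T)$ is exact; $\mathscr{V}$ is any exhaustive family such that, for every $n\in\mathbb{N}$, $\mu(T^{-n}V\triangle V)=o(\mu(V))$ as $V\nearrow X$; $\mathcal{G}=L^\infty(X,\mathscr{A},\mu;\mathbb{R})$; $\mathcal{L}=L^1(X,\mathscr{A},\mu;\mathbb{R})$. (H2) $T$ is an automorphism and $(X,\mathscr{A},\mu,T)$ has the K-property, with respect to a sub-$\sigma$-algebra $\mathscr{B}\subset\mathscr{A}$; $\mathscr{V}$ is any exhaustive family such that, for every $n\in\mathbb{N}$, $\mu(T^{-n}V\triangle V)=o(\mu(V))$ as $V\nearrow X$; $\mathcal{G}$ is the closure, in $L^\infty(X,\mathscr{A},\mu;\mathbb{R})$, of $\bigcup_{m>0}L^\infty(\mathscr{B}_m)$, where $\mathscr{B}_m:=T^m\mathscr{B}$; $\mathcal{L}=L^1(X,\mathscr{A},\mu;\mathbb{R})$. Then: (a) (GLM1) holds, that is, for all $F\in\mathcal{G}$ and all $g\in\mathcal{L}$ with $\mu(g)=0$, $\lim_{n\to\infty}\mu((F\circ T^n)g)=0$. (b) (LLM) holds, that is, for all $f\in\mathcal{L}\cap\mathcal{G}$ and all $g\in\mathcal{L}$, $\lim_{n\to\infty}\mu((f\circ T^n)g)=0$. Moreover,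 if the infinite-volume average $\overline{\mu}(F)$ exists for every $F\in\mathcal{G}$, then: (c) (GGM2) implies (GLM2), that is, if $$\lim_{V\nearrow X,\ n\to\infty}\mu_V((F\circ T^n)G)=\overline{\mu}(F)\,\overline{\mu}(G)\quad\text{for all }F,G\in\mathcal{G},$$ then $$\lim_{n\to\infty}\mu((F\circ T^n)g)=\overline{\mu}(F)\,\mu(g)\quad\text{for all }F\in\mathcal{G},\ g\in\mathcal{L}.$$ (d) If for every $F\in\mathcal{G}$ there exists $g_F\in\mathcal{L}$ with $\mu(g_F)\neq 0$ such that $$\lim_{n\to\infty}\mu((F\circ T^n)g_F)=\overline{\mu}(F)\,\mu(g_F),$$ then (GLM2) holds, that is, $\lim_{n\to\infty}\mu((F\circ T^n)g)=\overline{\mu}(F)\,\mu(g)$ for all $F\in\mathcal{G}$ and $g\in\mathcal{L}$.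
   Context: Measure-preserving dynamical system: $(X,\mathscr{A})$ is a measurable space, $\mu$ is an infinite, $\sigma$-finite measure on it, and $T:X\to X$ is a measurable surjective map with $\mu(T^{-1}A)=\mu(A)$ for all $A\in\mathscr{A}$. For an integrable function $g$, write $\mu(g):=\int_X g\,d\mu$. Exhaustive family: a class $\mathscr{V}\subset\mathscr{A}_f:=\{A\in\mathscr{A}:\mu(A)<\infty\}$ that contains at least one sequence $(V_j)_{j\in\mathbb{N}}$, increasing with respect to inclusion, with $\bigcup_j V_j=X$. Infinite-volume limit: for $\phi:\mathscr{V}\to\mathbb{R}$, $\lim_{V\nearrow X}\phi(V)=\ell$ means $\lim_{M\to\infty}\sup_{V\in\mathscr{V},\,\mu(V)\ge M}|\phi(V)-\ell|=0$. Accordingly, $\phi(V)=o(\mu(V))$ as $V\nearrow X$ means $\lim_{V\nearrow X}\phi(V)/\mu(V)=0$. Joint infinite-volume and time limit: for $\phi:\mathscr{V}\times\mathbb{N}\to\mathbb{R}$, $\lim_{V\nearrow X,\,n\to\infty}\phi(V,n)=\ell$ means $\lim_{M\to\infty}\sup_{V\in\mathscr{V},\,\mu(V)\ge M,\,n\ge M}|\phi(V,n)-\ell|=0$. For $F\in L^\infty$ and $V\in\mathscr{V}$, $\mu_V(F):=\mu(V)^{-1}\int_V F\,d\mu$. The infinite-volume average of $F$ is $\overline{\mu}(F):=\lim_{V\nearrow X}\mu_V(F)$, when this limit exists (in $\mathbb{R}$). Let $\mathscr{N}$ denote the null $\sigma$-algebra, consisting of the zero-measure sets and their complements. For two $\sigma$-algebras,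 $\mathscr{C}=\mathscr{D}$ mod $\mu$ means that for every $C\in\mathscr{C}$ there is $D\in\mathscr{D}$ with $\mu(C\triangle D)=0$, and vice versa. Exactness: $(X,\mathscr{A},\mu,T)$ is exact if $\bigcap_{n=0}^\infty T^{-n}\mathscr{A}=\mathscr{N}$ mod $\mu$. K-property: an invertible measure-preserving system (i.e. $T$ is an automorphism of the measure space) has the K-property if there is a $\sigma$-algebra $\mathscr{B}\subset\mathscr{A}$ such that (i) $\mathscr{B}\subset T\mathscr{B}$; (ii) $\bigvee_{n=0}^\infty T^n\mathscr{B}=\mathscr{A}$ mod $\mu$; (iii) $\bigcap_{n=0}^\infty T^{-n}\mathscr{B}=\mathscr{N}$ mod $\mu$. $L^\infty(\mathscr{B}_m)$ denotes the space of real-valued, $\mathscr{B}_m$-measurable, essentially bounded functions. *)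

(* Defs.v *)
From HB Require Import structures.
From mathcomp Require Import all_boot all_order all_algebra.
From mathcomp Require Import all_classical all_reals all_analysis.
Set Implicit Arguments.
Unset Strict Implicit.
Unset Printing Implicit Defensive.
Import Order.TTheory GRing.Theory Num.Theory.
Import numFieldNormedType.Exports.
Local Open Scope classical_set_scope.
Local Open Scope ring_scope.

Section defs.
Context {d : measure_display} {X : measurableType d} {R : realType}.
Variable mu : {measure set X -> \bar R}.
Implicit Types (T S : X -> X) (V A : set X) (VV B C D : set (set X))
  (F G : X -> R) (GG LL : set (X -> R)).

Definition measure_preserving T :=
  measurable_fun setT T /\
  forall A, measurable A -> mu (T @^-1` A) = mu A.

Definition automorphism T := measure_preserving T /\
  exists S, [/\ cancel T S, cancel S T & measure_preserving S].

(** Infinite-volume limits.  Exhaustiveness of [VV] and [mu setT = +oo] make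
    the sets below nonempty for every [M], so that [ereal_sup] never takes its
    value [-oo] on the empty set. *)

Definition exhaustive VV :=
  (forall V, VV V -> measurable V /\ (mu V < +oo)%E) /\
  exists V_ : nat -> set X, [/\ forall j, VV (V_ j),
    forall i j, (i <= j)%N -> V_ i `<=` V_ j & \bigcup_j V_ j = setT].

Definition volume_lim VV (phi : set X -> R) (l : R) :=
  ereal_sup [set `|phi V - l|%:E | V in [set V | VV V /\ (M%:E <= mu V)%E]]
    @[M --> +oo%R] --> 0%E.

Definition volume_time_lim VV (phi : set X -> nat -> R) (l : R) :=
  ereal_sup [set `|phi V n - l|%:E |
      V in [set V | VV V /\ (M%:E <= mu V)%E] & n in [set n | M <= n%:R]]
    @[M --> +oo%R] --> 0%E.

Definition volume_littleo VV (phi : set X -> R) :=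
  volume_lim VV (fun V => phi V / fine (mu V)) 0.

Definition mean V F : R := (fine (mu V))^-1 * \int[mu]_(x in V) F x.

Definition has_average VV F := exists l : R, volume_lim VV (mean ^~ F) l.

Definition average VV F : R := get [set l : R | volume_lim VV (mean ^~ F) l].

Definition asymptotically_invariant VV T := forall n : nat,
  volume_littleo VV (fun V => fine (mu ((iter n T @^-1` V) `+` V))).

(** Families of sets modulo [mu]. *)

Definition null_sigma_algebra : set (set X) :=
  [set A | measurable A /\ (mu A = 0%E \/ mu (~` A) = 0%E)].

Definition eq_mod C D :=
  (forall A, C A -> exists2 A', D A' & mu (A `+` A') = 0%E) /\
  (forall A', D A' -> exists2 A, C A & mu (A `+` A') = 0%E).

Definition preimages T (n : nat) C : set (set X) :=
  [set iter n T @^-1` A | A in C].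

Definition images T (n : nat) C : set (set X) := [set iter n T @` A | A in C].

Definition exact_system T :=
  eq_mod (\bigcap_n preimages T n measurable) null_sigma_algebra.

Definition K_property T B :=
  [/\ sigma_algebra setT B, B `<=` measurable & B `<=` images T 1 B] /\
  eq_mod <<s \bigcup_n images T n B >> measurable /\
  eq_mod (\bigcap_n preimages T n B) null_sigma_algebra.

(** Spaces of observables.  Elements of L^1 and L^infty are represented by
    functions, not by their classes modulo a.e. equality; all the sets below are
    saturated for a.e. equality among measurable functions, except [Linfty_sub],
    which only serves to form [K_observables]. *)

Definition L1 : set (X -> R) := [set f | f \in Lfun mu 1%E].

Definition Linfty : set (X -> R) := [set f | f \in Lfun mu +oo%E].

Definition Linfty_sub B : set (X -> R) :=
  [set f | Linfty f /\ forall Y : set R, measurable Y -> B (f @^-1` Y)].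

Definition Linfty_closure GG : set (X -> R) :=
  [set F | Linfty F /\ forall e : R, 0 < e ->
    exists2 G, GG G & ('N[mu]_+oo[EFin \o (F \- G)%R] < e%:E)%E].

Definition K_observables T B : set (X -> R) :=
  Linfty_closure (\bigcup_(m in [set m : nat | (0 < m)%N])
                    Linfty_sub (images T m B)).

Definition exact_case T VV GG LL :=
  [/\ exact_system T, asymptotically_invariant VV T, GG = Linfty & LL = L1].

Definition K_case T VV GG LL := automorphism T /\
  exists B, [/\ K_property T B, asymptotically_invariant VV T,
    GG = K_observables T B & LL = L1].

(** Mixing properties; the letters G and L stand for global and local. *)

Definition GLM1 T GG LL := forall F g, GG F -> LL g ->
  \int[mu]_x g x = 0 ->
  (\int[mu]_x (F (iter n T x) * g x)) @[n --> \oo] --> (0 : R).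

Definition LLM T GG LL := forall f g, LL f -> GG f -> LL g ->
  (\int[mu]_x (f (iter n T x) * g x)) @[n --> \oo] --> (0 : R).

Definition GLM2_at T VV F g :=
  (\int[mu]_x (F (iter n T x) * g x)) @[n --> \oo] -->
    average VV F * \int[mu]_x g x.

Definition GLM2 T VV GG LL := forall F g, GG F -> LL g -> GLM2_at T VV F g.

Definition GGM2 T VV GG := forall F G, GG F -> GG G ->
  volume_time_lim VV (fun V n => mean V (fun x => F (iter n T x) * G x))
    (average VV F * average VV G).

End defs.

(* Main.v *)
Require Import Defs.
From HB Require Import structures.
From mathcomp Require Import all_boot all_order all_algebra.
From mathcomp Require Import all_classical all_reals all_analysis.
From mathcomp Require Import measurable_realfun ess_sup_inf ring lra.
Set Implicit Arguments.
Unset Strict Implicit.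
Unset Printing Implicit Defensive.
Import Order.TTheory GRing.Theory Num.Theory.
Import numFieldNormedType.Exports.
Local Open Scope classical_set_scope.
Local Open Scope ring_scope.

(** Everything rests on the uniform decay of [mu((F o T^n) g)] for [mu(g) = 0]
    (Lin's theorem, for the tower [T^-n A] or [T^-n B]), which is proved without
    conditional expectations or weak-* compactness.  Were there, for each [n],
    a [C_n]-measurable [u] with [|u| <= c] and [mu(u g) >= e], such [u] would
    form decreasing convex sets [K_n].  By the parallelogram law, near-minimisers
    of [mu(u^2 |g|)] over [K_n] are Cauchy, hence converge [|g| mu]-a.e.; their
    limsup is tail-measurable, so it is a constant [a], and
    [mu(u_k g) --> a mu(g) = 0], a contradiction.

    Since [mu((F o T^n) g)] asymptotically depends only on [mu(g)], one may then
    replace [g] by [mu(g) 1_V / mu(V)], i.e. [mu((F o T^n) g)] by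
    [mu(g) mu_V(F o T^n)], with [V] as large as desired: this yields (LLM), and
    (GLM2) from (GGM2) with [G = 1]. *)

(** * Integrability of bounded multiples, and functions satisfying a 0-1 law *)

Section real_integral.
Context {d : measure_display} {X : measurableType d} {R : realType}.
Variable mu : {measure set X -> \bar R}.
Implicit Types u v g : X -> R.

Lemma integrable_ae_bounded_mul (c : R) u g :
  measurable_fun setT u -> {ae mu, forall x, `|u x| <= c} ->
  mu.-integrable setT (EFin \o g) ->
  mu.-integrable setT (EFin \o (fun x => u x * g x)).
Proof.
move=> mu_ uc ig; have mg := measurable_int _ ig.
have mug : measurable_fun setT (EFin \o (fun x => u x * g x)).
  by apply/measurable_EFinP/measurable_funM => //; exact/measurable_EFinP.
apply/integrableP; split => //.
have /integrableP[_ /le_lt_trans] := integrableZl measurableT c (integrable_norm ig).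
apply; apply: ae_ge0_le_integral => //.
- exact: measurableT_comp.
- apply: measurableT_comp => //.
  exact: measurable_int (integrableZl measurableT c (integrable_norm ig)).
apply: filterS uc => x uxc _ /=.
by rewrite lee_fin !normrM normr_id ler_wpM2r// (le_trans uxc)// ler_norm.
Qed.

Lemma normr_Rintegral_ae_bounded_mul (c : R) u g :
  0 <= c -> measurable_fun setT u -> {ae mu, forall x, `|u x| <= c} ->
  mu.-integrable setT (EFin \o g) ->
  `|\int[mu]_x (u x * g x)| <= c * \int[mu]_x `|g x|.
Proof.
move=> c0 mu_ uc ig; have iug := integrable_ae_bounded_mul mu_ uc ig.
have icg := integrableZl measurableT c (integrable_norm ig).
rewrite (le_trans (le_normr_Rintegral _ iug))// -RintegralZl//; last first.
  exact: integrable_norm.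
have iaug := integrable_norm iug.
rewrite -lee_fin [leLHS]fineK ?[leRHS]fineK; [|exact: integrable_fin_num..].
apply: ae_ge0_le_integral => //.
- exact: measurable_int iaug.
- by move=> x _; rewrite lee_fin mulr_ge0.
- exact: measurable_int icg.
by apply: filterS uc => x uxc _; rewrite lee_fin normrM ler_wpM2r.
Qed.

Lemma integrable_bounded_mul (c : R) u g :
  measurable_fun setT u -> (forall x, `|u x| <= c) ->
  mu.-integrable setT (EFin \o g) ->
  mu.-integrable setT (EFin \o (fun x => u x * g x)).
Proof. by move=> mu_ uc; apply: integrable_ae_bounded_mul mu_ _; exact: aeW. Qed.

Lemma negligible_bigcup_count (I : countType) (N : I -> set X) :
  (forall i, mu.-negligible (N i)) -> mu.-negligible (\bigcup_i N i).
Proof.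
move=> negN.
apply: (@negligibleS _ _ _ mu (\bigcup_n oapp N set0 (unpickle n))).
  by move=> x [i _ Nx]; exists (pickle i) => //; rewrite pickleK.
apply: negligible_bigcup => n; case: unpickle => [i|] /=; first exact: negN.
exact: negligible_set0.
Qed.

(** For each rational [q], one of [u <= q] and its complement is null. Once these countably many
    null sets are removed, two points with different values of [u] cannot both remain: a rational
    between the values would have removed one of them. *)
Lemma ae_const (u : X -> R) :
  measurable_fun setT u ->
  (forall r, mu [set x | u x <= r] = 0%E \/ mu (~` [set x | u x <= r]) = 0%E) ->
  exists c, {ae mu, forall x, u x = c}.
Proof.
move=> mu_ u01.
pose N q := if `[< mu [set x | u x <= ratr q] = 0%E >]
            then [set x | u x <= ratr q] else ~` [set x | u x <= ratr q].
have mN q : measurable [set x | u x <= ratr q].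
  rewrite -[X in measurable X]setTI.
  exact: (@measurable_fun_le _ _ _ _ u (cst (ratr q))).
have negN q : mu.-negligible (N q).
  rewrite /N; case: asboolP => [N0|Nn0].
    by exists [set x | u x <= ratr q]; split.
  exists (~` [set x | u x <= ratr q]); split => //; first exact: measurableC.
  by case: (u01 (ratr q)).
have negU : mu.-negligible (\bigcup_q N q) by exact: negligible_bigcup_count.
have constU x y : ~ (\bigcup_q N q) x ->
    ~ (\bigcup_q N q) y -> u x <= u y.
  move=> Nx Ny; rewrite leNgt; apply/negP => yx.
  have [q /andP[]] := rat_in_itvoo yx; rewrite !bnd_simp => yq qx.
  have NqU z : N q z -> (\bigcup_q N q) z by exists q.
  move: (Nx) (Ny) => /(contra_not (NqU x)) + /(contra_not (NqU y)).
  rewrite /N; case: asboolP => _ /=; first by move=> _; apply; exact: ltW.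
  by move=> + _; apply; apply/negP; rewrite -ltNge.
(* If no point remains, the whole space is negligible and any constant serves. *)
have [[x0 Nx0]|allN] :=
    pselect (exists x, ~ (\bigcup_q N q) x).
  exists (u x0); apply: negligibleS negU => x /= uxc; apply: contrapT => Nx.
  by apply: uxc; apply/eqP; rewrite eq_le !constU.
exists 0; apply: negligibleS negU => x _; apply: contrapT => Nx.
by apply: allN; exists x.
Qed.
End real_integral.

(** The sum of the increments weighted by [|g|] is integrable, hence finite a.e.; dividing by
    [|g x|], where it is nonzero, makes the telescoping series absolutely convergent. *)
Lemma ae_cvg_of_L1_summable {d : measure_display} {X : measurableType d}
    {R : realType} (mu : {measure set X -> \bar R}) (u : nat -> X -> R)
    (g : X -> R) (B : R) :
  0 <= B ->
  (forall k, mu.-integrable setT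
     (EFin \o (fun x => `|u k.+1 x - u k x| * `|g x|))) ->
  (forall k, \int[mu]_x (`|u k.+1 x - u k x| * `|g x|)
     <= B / (2 ^ k.+1)%:R) ->
  {ae mu, forall x, g x != 0 -> cvgn (u ^~ x)}.
Proof.
move=> B0 iD Dle.
pose D k x : \bar R := (`|u k.+1 x - u k x| * `|g x|)%:E.
have D0 k x : (0 <= D k x)%E by rewrite lee_fin mulr_ge0.
have mD k : measurable_fun setT (D k) by exact: measurable_int (iD k).
have sumD : (\int[mu]_x (\sum_(0 <= k <oo) D k x) < +oo)%E.
  rewrite integral_nneseries//.
  (* The summand [0] gives the series the shape required by [epsilon_trick], which bounds it by
     [B]. *)
  have /le_lt_trans : (\sum_(0 <= k <oo) \int[mu]_x D k x <=
      \sum_(0 <= k <oo) (0 + (B / (2 ^ k.+1)%:R)%:E))%E.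
    apply: lee_nneseries => [k _ _|k _]; first exact: integral_ge0.
    rewrite add0e -[leLHS]fineK ?lee_fin; first exact: Dle.
    exact: integrable_fin_num (iD k).
  apply; apply: le_lt_trans (epsilon_trick _ _ B0) _ => //.
  by rewrite eseries0// add0e ltry.
have iS : mu.-integrable setT (fun x => \sum_(0 <= k <oo) D k x)%E.
  apply/integrableP; split; first exact: ge0_emeasurable_sum.
  by under eq_integral do rewrite gee0_abs ?nneseries_ge0//.
apply: filterS (integrable_ae measurableT iS) => x /(_ I) Sfin gx0.
have ngx : 0 < `|g x| by rewrite normr_gt0.
have cvgN : cvgn [normed series (telescope (u ^~ x))].
  apply: nondecreasing_is_cvgn.
    by apply/nondecreasing_series => k _ _; exact: normr_ge0.
  exists (fine (\sum_(0 <= k <oo) D k x)%E / `|g x|) => _ [n _ <-].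
  rewrite ler_pdivlMr// /series /= mulr_suml -lee_fin fineK//.
  rewrite -sumEFin.
  exact: (@nneseries_lim_ge _ (D ^~ x) xpredT 0 n).
have := normed_cvg cvgN; rewrite telescopeK => /(is_cvgD (is_cvg_cst (u 0%N x))).
by congr (cvgn _); apply/funext => n /=; rewrite addrC subrK.
Qed.

(** Lets a limsup be computed from functions adapted to an arbitrarily late sigma-algebra. *)
Lemma limn_esup_shiftn (R : realType) (u : (\bar R)^nat) (n : nat) :
  limn_esup (fun k => u (k + n)%N) = limn_esup u.
Proof.
rewrite !limn_esup_lim.
suff -> : esups (fun k => u (k + n)%N) = fun k => esups u (k + n)%N.
  apply/cvg_lim => //; rewrite (cvg_shiftn n (esups u)).
  exact: is_cvg_esups.
apply/funext => k; rewrite /esups /=; congr ereal_sup.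
apply/seteqP; split=> [_ [m /= km <-]|_ [m /= knm <-]].
  by exists (m + n)%N => //=; rewrite leq_add2r.
by exists (m - n)%N; rewrite /= ?leq_subRL ?subnK ?leq_subRL// 1?addnC//
  (leq_trans _ knm)// leq_addl.
Qed.

(** * Decreasing sigma-algebras with trivial tail *)

Section tail_sigma_algebra.
Context {d : measure_display} {X : measurableType d} {R : realType}.
Variables (mu : {measure set X -> \bar R}) (C : nat -> set (set X)).
Hypothesis algC : forall n, sigma_algebra setT (C n).
Hypothesis subC : forall n, C n `<=` measurable.
Hypothesis decrC : forall n, C n.+1 `<=` C n.
Hypothesis tailC : forall A, (forall n, C n A) -> mu A = 0%E \/ mu (~` A) = 0%E.

(** Stated through the measurable space generated by [C n], so that closure of measurability under
    composition, sums and limsup applies directly; [C n] being a sigma-algebra, nothing is added to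
    it. *)
Definition adapted n (u : X -> R) :=
  measurable_fun setT (u : g_sigma_algebraType (C n) -> R).

Lemma adaptedP n u : adapted n u <-> forall Y, measurable Y -> C n (u @^-1` Y).
Proof.
split=> [mu_ Y mY|Cu _ Y mY].
  by have := mu_ measurableT Y mY; rewrite setTI /measurable /= sigma_algebra_id.
by rewrite setTI /measurable /= sigma_algebra_id//; exact: Cu.
Qed.

Lemma decrC_leq m n : (m <= n)%N -> C n `<=` C m.
Proof.
move=> /subnK <-; elim: (n - m)%N => [|k IH] //.
by rewrite addSn => A /decrC; exact: IH.
Qed.

Lemma adapted_leq m n u : (m <= n)%N -> adapted n u -> adapted m u.
Proof. by move=> mn /adaptedP Cu; apply/adaptedP => Y /Cu; exact: decrC_leq. Qed.

Lemma adapted_measurable n u : adapted n u -> measurable_fun setT u.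
Proof. by move=> /adaptedP Cu _ Y mY; rewrite setTI; apply: (@subC n); exact: Cu. Qed.

Lemma adapted_comp n (h : R -> R) u :
  measurable_fun setT h -> adapted n u -> adapted n (h \o u).
Proof. exact: measurableT_comp. Qed.

Lemma tail_limit (u : nat -> X -> R) : (forall k, adapted k (u k)) ->
  exists c : R, {ae mu, forall x, cvgn (u ^~ x) -> u ^~ x @ \oo --> c}.
Proof.
(* Where the limsup is infinite, [fine] sets [l] to 0; this keeps [l] real-valued and
   tail-measurable, and such points are outside the conclusion. *)
move=> Cu.
pose l x := fine (limn_esup (fun k => (u k x)%:E)).
have Cl n : adapted n l.
  rewrite /adapted; apply: measurableT_comp; first exact: fine_measurable.
  under eq_fun do rewrite -(limn_esup_shiftn _ n).
  apply: (@measurable_fun_limn_esup _ (g_sigma_algebraType (C n)) R setT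
    (fun k x => (u (k + n)%N x)%:E)) => k.
  apply/measurable_EFinP; apply: (@adapted_leq _ (k + n)); last exact: Cu.
  exact: leq_addl.
have [c lc] : exists c, {ae mu, forall x, l x = c}.
  apply: ae_const; first exact: (@adapted_measurable 0).
  move=> r; apply: tailC => n.
  have /adaptedP /(_ _ (measurable_itv `]-oo, r])) := Cl n.
  by congr (C n _); apply/seteqP; split => x /=; rewrite in_itv.
exists c; apply: filterS lc => x <- cvgu.
rewrite /l is_cvg_limn_esupE; last first.
  by apply/cvg_ex; exists (limn (u ^~ x))%:E; apply: cvg_EFin => //; exact: nearW.
have -> : (limn (fun k => (u k x)%:E)) = (limn (u ^~ x))%:E.
  by apply/cvg_lim => //; apply: cvg_EFin => //; exact: nearW.
exact: cvgu.
Qed.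

End tail_sigma_algebra.

(** * Near-minimisers over decreasing sets *)

Section near_minimisers.
Context {R : realType} (T : Type) (Q : T -> R) (K : nat -> set T) (M : R).
Hypothesis K0 : forall n, K n !=set0.
Hypothesis decrK : forall m n, (m <= n)%N -> K n `<=` K m.
Hypothesis Q0 : forall u, 0 <= Q u.
Hypothesis QM : forall n u, K n u -> Q u <= M.

(* [A] is the limit of the increasing sequence [inf (Q @` K n)]. *)
Lemma near_minimisers : exists A, forall (e : R) k, 0 < e ->
  exists N u, [/\ (k <= N)%N, K N u, Q u <= A + e & forall w, K N w -> A - e <= Q w].
Proof.
pose a n := inf (Q @` K n).
have hi n : has_inf (Q @` K n).
  split; first by case: (K0 n) => u Ku; exists (Q u), u.
  by exists 0 => _ [u _ <-].
have aQ n u : K n u -> a n <= Q u.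
  by move=> Ku; apply: ge_inf; [case: (hi n)|exists u].
have aM n : a n <= M by case: (K0 n) => u Ku; apply: le_trans (aQ _ _ Ku) (QM Ku).
have ha : has_sup (range a).
  by split; [exists (a 0%N), 0%N|exists M => _ [n _ <-]].
exists (sup (range a)) => e k e0.
have [_ [n _ <-] an] := sup_adherent e0 ha.
have [_ [u Ku <-] Qu] := inf_adherent e0 (hi (maxn k n)).
exists (maxn k n), u; split => //; first exact: leq_maxl.
  rewrite ltW// (lt_le_trans Qu)// lerD2r.
  by apply: ub_le_sup; [case: ha|exists (maxn k n)].
move=> w Kw; rewrite ltW// (lt_le_trans an)//; apply: aQ.
by apply: decrK Kw; exact: leq_maxr.
Qed.

End near_minimisers.

(** * Hilbert-space geometry of L^2 for the finite measure [|g| mu] *)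

Section weighted_L2.
Context {d : measure_display} {X : measurableType d} {R : realType}.
Variables (mu : {measure set X -> \bar R}) (g : X -> R).
Hypothesis ig : mu.-integrable setT (EFin \o g).

Definition weighted_sqnorm (u : X -> R) := \int[mu]_x (u x ^+ 2 * `|g x|).
Local Notation Q := weighted_sqnorm.

Let ing : mu.-integrable setT (EFin \o (fun x => `|g x|)).
Proof. exact: integrable_norm ig. Qed.

Let iZ (r : R) (f : X -> R) : mu.-integrable setT (EFin \o f) ->
  mu.-integrable setT (EFin \o (fun x => r * f x)).
Proof. exact: integrableZl. Qed.

Lemma integrable_sqr_mul (c : R) (u : X -> R) :
  measurable_fun setT u -> (forall x, `|u x| <= c) ->
  mu.-integrable setT (EFin \o (fun x => u x ^+ 2 * `|g x|)).
Proof.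
move=> mu_ uc; apply: (@integrable_bounded_mul _ _ _ mu (c ^+ 2)) => //.
  exact: measurable_funX.
by move=> x; rewrite normrX ler_pXn2r ?nnegrE//; apply: le_trans (uc x).
Qed.

(** The midpoint replaces the sum because the sets to which this is applied are convex. *)
Lemma parallelogram (c : R) (u v : X -> R) :
  measurable_fun setT u -> measurable_fun setT v ->
  (forall x, `|u x| <= c) -> (forall x, `|v x| <= c) ->
  Q (fun x => v x - u x) + 4 * Q (fun x => 2^-1 * (u x + v x)) =
  2 * Q u + 2 * Q v.
Proof.
move=> mu_ mv uc vc.
have iu := integrable_sqr_mul mu_ uc; have iv := integrable_sqr_mul mv vc.
have iB : mu.-integrable setT (EFin \o (fun x => (v x - u x) ^+ 2 * `|g x|)).
  apply: (@integrable_sqr_mul (c + c)); first exact: measurable_funB.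
  by move=> x; rewrite (le_trans (ler_normB _ _))// lerD.
have iD : mu.-integrable setT
    (EFin \o (fun x => (2^-1 * (u x + v x)) ^+ 2 * `|g x|)).
  apply: (@integrable_sqr_mul c).
    by apply: measurable_funM => //; exact: measurable_funD.
  move=> x; rewrite normrM gtr0_norm// ler_pdivrMl// (le_trans (ler_normD _ _))//.
  by rewrite mulr_natl mulr2n lerD.
rewrite /weighted_sqnorm -!RintegralZl// -!RintegralD//; [|exact: iZ..].
by apply: eq_Rintegral => x _; field.
Qed.

(** The parameter [t] stays free: taken as [2 ^+ k.+1] for the [k]-th increment, it makes both terms
    of order [2 ^- k]. *)
Lemma L1_le_weighted_L2 (c t : R) (u : X -> R) :
  measurable_fun setT u -> (forall x, `|u x| <= c) -> 0 < t ->
  \int[mu]_x (`|u x| * `|g x|) <= t * Q u + t^-1 * \int[mu]_x `|g x|.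
Proof.
move=> mu_ uc t0; have iu := integrable_sqr_mul mu_ uc.
rewrite /weighted_sqnorm -!RintegralZl// -RintegralD//; [|exact: iZ..].
apply: le_Rintegral => //.
- apply: (@integrable_bounded_mul _ _ _ mu c (fun x => `|u x|)) => //.
    exact: measurableT_comp.
  by move=> x; rewrite normr_id.
- exact: (integrableD measurableT (iZ t iu) (iZ t^-1 ing)).
move=> x _; rewrite mulrA -mulrDl ler_wpM2r// -(real_normK (num_real (u x))).
(* Plays the role of the Cauchy-Schwarz inequality, via [a <= t a^2 + t^-1]. *)
set a := `|u x|; rewrite -subr_ge0.
have -> : t * a ^+ 2 + t^-1 - a = t^-1 * ((t * a - 1) ^+ 2 + t * a).
  by field; rewrite gt_eqF.
by rewrite mulr_ge0 ?invr_ge0 ?addr_ge0 ?sqr_ge0 ?mulr_ge0 ?normr_ge0 ?ltW.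
Qed.
End weighted_L2.

(** * Uniform decay along a decreasing sequence of sigma-algebras *)

Section tail_mixing.
Context {d : measure_display} {X : measurableType d} {R : realType}.
Variables (mu : {measure set X -> \bar R}) (C : nat -> set (set X)).
Hypothesis algC : forall n, sigma_algebra setT (C n).
Hypothesis subC : forall n, C n `<=` measurable.
Hypothesis decrC : forall n, C n.+1 `<=` C n.
Hypothesis tailC : forall A, (forall n, C n A) -> mu A = 0%E \/ mu (~` A) = 0%E.

(** The bound is one-sided so that its negation is a convex condition on [u]; replacing [u] by [- u]
    gives the other side. *)
Lemma tail_mixing (g : X -> R) (c e : R) :
  mu.-integrable setT (EFin \o g) -> \int[mu]_x g x = 0 -> 0 < e ->
  exists n, forall u, @adapted _ _ _ C n u -> (forall x, `|u x| <= c) ->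
    \int[mu]_x (u x * g x) < e.
Proof.
move=> ig g0 e0; apply: contrapT => noN.
have mC n (u : X -> R) : adapted C n u -> measurable_fun setT u.
  exact: adapted_measurable.
pose K n : set (X -> R) := [set u | [/\ adapted C n u, (forall x, `|u x| <= c) &
  e <= \int[mu]_x (u x * g x)]].
have K0 n : K n !=set0.
  apply: contrapT => Kn0; apply: noN; exists n => u Cu uc; rewrite ltNge.
  by apply/negP => eu; apply: Kn0; exists u.
have decrK m n : (m <= n)%N -> K n `<=` K m.
  by move=> mn u [Cu uc eu]; split => //; exact: adapted_leq mn Cu.
pose Q := weighted_sqnorm mu g.
have Q0 u : 0 <= Q u by apply: Rintegral_ge0 => x _; rewrite mulr_ge0 ?sqr_ge0.
have QM n u : K n u -> Q u <= c ^+ 2 * \int[mu]_x `|g x|.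
  move=> [/mC mu_ uc _]; rewrite -RintegralZl//; last exact: integrable_norm.
  apply: le_Rintegral => //; first exact: (@integrable_sqr_mul _ _ _ _ _ ig c).
    exact: (integrableZl measurableT (c ^+ 2) (integrable_norm ig)).
  move=> x _; rewrite ler_wpM2r// -(real_normK (num_real (u x))).
  by rewrite ler_pXn2r ?nnegrE ?normr_ge0// (le_trans _ (uc x)).
have [A nearA] := near_minimisers K0 decrK Q0 QM.
(* The squared distances are of order [eta k], so that the distances are of order [2 ^- k], hence
   summable. *)
pose eta (k : nat) : R := (4 ^+ k.+1)^-1.
have eta0 k : 0 < eta k by rewrite invr_gt0 exprn_gt0.
have /choice[u_ Ku_] k : exists u, exists N, [/\ (k <= N)%N, K N u, Q u <= A + eta k &
    forall w, K N w -> A - eta k <= Q w].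
  by have [N [u H]] := nearA (eta k) k (eta0 k); exists u, N.
have Kk k : K k (u_ k) by have [N [kN KN _ _]] := Ku_ k; exact: decrK KN.
have mu_ k : measurable_fun setT (u_ k) by have [/mC] := Kk k.
have uc k x : `|u_ k x| <= c by have [_ + _] := Kk k; apply.
(* Convexity, for two points taken from different sets of the decreasing sequence. *)
have mid m n p : (p <= m)%N -> (p <= n)%N -> forall u v, K m u -> K n v ->
    K p (fun x => 2^-1 * (u x + v x)).
  move=> pm pn u v [/(adapted_leq algC decrC pm) Cu ubd eu].
  move=> [/(adapted_leq algC decrC pn) Cv vbd ev]; split.
  - apply: (@measurable_funM _ (g_sigma_algebraType (C p)) R setT
      (cst 2^-1) (fun x => u x + v x)) => //.
    exact: (@measurable_funD _ (g_sigma_algebraType (C p)) R setT u v).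
  - move=> x; rewrite normrM gtr0_norm// ler_pdivrMl// (le_trans (ler_normD _ _))//.
    by rewrite mulr_natl mulr2n lerD.
  have iu := integrable_bounded_mul (mC _ _ Cu) ubd ig.
  have iv := integrable_bounded_mul (mC _ _ Cv) vbd ig.
  have -> : \int[mu]_x (2^-1 * (u x + v x) * g x) =
      2^-1 * (\int[mu]_x (u x * g x) + \int[mu]_x (v x * g x)).
    rewrite -RintegralD// -RintegralZl//; last exact: (integrableD measurableT iu iv).
    by apply: eq_Rintegral => x _; rewrite -mulrA mulrDl.
  lra.
(* The midpoint lies in the set of smaller index, [M] or [N], so one of the two lower bounds applies
   to it. The parallelogram law then gives at most [2 (A + eta k) + 2 (A + eta k) - 4 (A - eta
   k)]. *)
have Qdiff k : Q (fun x => u_ k.+1 x - u_ k x) <= 8 * eta k.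
  have [M [_ KM QkM lowM]] := Ku_ k; have [N [_ KN QkN lowN]] := Ku_ k.+1.
  have etaS : eta k.+1 <= eta k.
    by rewrite lef_pV2 ?posrE ?exprn_gt0// ler_eXn2l// ltr1n.
  pose w x := 2^-1 * (u_ k x + u_ k.+1 x).
  have Qw : A - eta k <= Q w.
    have [MN|NM] := leqP M N; first exact/lowM/(mid _ _ _ (leqnn M) MN).
    rewrite (le_trans _ (lowN _ (mid _ _ _ (ltnW NM) (leqnn N) _ _ KM KN)))//.
    by rewrite lerD2l lerN2.
  have := @parallelogram _ _ _ mu g ig c _ _ (mu_ k) (mu_ k.+1) (uc k) (uc k.+1).
  rewrite -/Q -/w => ?; lra.
(* With [t = 2 ^+ k.+1], the quadratic term is at most [8 / 2 ^+ k.+1]; the other one is the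
   integral of [|g|] divided by [2 ^+ k.+1]. *)
pose B := 8 + \int[mu]_x `|g x|.
have B0 : 0 <= B by rewrite addr_ge0// Rintegral_ge0.
have mdiff k : measurable_fun setT (fun x => u_ k.+1 x - u_ k x).
  exact: measurable_funB.
have diffc k x : `|u_ k.+1 x - u_ k x| <= c + c.
  by rewrite (le_trans (ler_normB _ _))// lerD.
have cvgu : {ae mu, forall x, g x != 0 -> cvgn (u_ ^~ x)}.
  apply: (ae_cvg_of_L1_summable B0) => k.
    apply: (@integrable_bounded_mul _ _ _ mu (c + c)
      (fun x => `|u_ k.+1 x - u_ k x|)); last exact: integrable_norm.
      exact: measurableT_comp.
    by move=> x; rewrite normr_id.
  have t0 : 0 < 2 ^+ k.+1 :> R by rewrite exprn_gt0.
  apply: le_trans (L1_le_weighted_L2 ig (mdiff k) (diffc k) t0) _.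
  rewrite -/Q; have := Qdiff k; rewrite natrX /B (mulrDl 8) => Qd.
  apply: lerD; last by rewrite mulrC.
  rewrite (le_trans (ler_wpM2l (ltW t0) Qd))//.
  rewrite /eta; have -> : 4 ^+ k.+1 = 2 ^+ k.+1 * 2 ^+ k.+1 :> R.
    by rewrite -exprMn -natrM.
  by rewrite le_eqVlt; apply/orP; left; apply/eqP; field; rewrite gt_eqF.
have [a ua] := tail_limit algC subC decrC tailC (fun k => let: And3 Cu _ _ := Kk k in Cu).
have [] := @dominated_convergence _ _ _ mu setT measurableT
  (fun k x => (u_ k x * g x)%:E) (fun x => (a * g x)%:E) (fun x => (c * `|g x|)%:E).
- by move=> k; exact: measurable_int (integrable_bounded_mul (mu_ k) (uc k) ig).
- exact: measurable_int (integrableZl measurableT a ig).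
- apply: filterS2 cvgu ua => x cvgx ax _; apply: cvg_EFin; first exact: nearW.
  (* Convergence of [u_] is known only where [g] is nonzero; elsewhere the products vanish. *)
  have [gx0|/cvgx /ax uxa] := eqVneq (g x) 0.
    by rewrite gx0 mulr0; under eq_fun do rewrite mulr0; exact: cvg_cst.
  by apply: cvgM => //; exact: cvg_cst.
- exact: (integrableZl measurableT c (integrable_norm ig)).
- by apply: aeW => x k _; rewrite lee_fin normrM ler_wpM2r.
move=> _ _; have -> : (\int[mu]_x (a * g x)%:E = 0)%E.
  rewrite -[LHS]fineK; last exact: integrable_fin_num (integrableZl measurableT a ig).
  by congr _%:E; have := RintegralZl a measurableT ig; rewrite g0 mulr0.
(* The integrals tend to 0, whereas membership in [K n] keeps each of them at least [e]. *)
move=> /fine_cvgP[_] /cvgr_lt.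
move=> /(_ e e0) [n _ /(_ n (leqnn n))] /=; apply/negP; rewrite -leNgt.
by have [] := Kk n.
Qed.
End tail_mixing.

(** For [m >= n], [f m] and its opposite are both adapted to [C n], so the uniform bound at the
    single index [n] controls all later terms. *)
Lemma tail_mixing_cvg {d : measure_display} {X : measurableType d}
    {R : realType} (mu : {measure set X -> \bar R}) (C : nat -> set (set X))
    (f : nat -> X -> R) (c : R) (g : X -> R) :
  (forall n, sigma_algebra setT (C n)) -> (forall n, C n `<=` measurable) ->
  (forall n, C n.+1 `<=` C n) ->
  (forall A, (forall n, C n A) -> mu A = 0%E \/ mu (~` A) = 0%E) ->
  (forall n, adapted C n (f n)) -> (forall n x, `|f n x| <= c) ->
  mu.-integrable setT (EFin \o g) -> \int[mu]_x g x = 0 ->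
  (\int[mu]_x (f n x * g x)) @[n --> \oo] --> (0 : R).
Proof.
move=> algC subC decrC tailC Cf fc ig g0; apply/cvgrPdist_lt => e e0.
have [n fn] := tail_mixing algC subC decrC tailC c ig g0 e0.
exists n => // m /= nm; rewrite sub0r normrN ltr_norml.
have Cfm : adapted C n (f m) by exact: adapted_leq nm (Cf m).
rewrite fn// andbT ltrNl.
have : \int[mu]_x (- f m x * g x) < e.
  apply: fn; last by move=> x; rewrite normrN.
  exact: adapted_comp (@oppr_measurable R setT) Cfm.
suff -> : \int[mu]_x (- f m x * g x) = - \int[mu]_x (f m x * g x) by [].
have ifg := integrable_bounded_mul (adapted_measurable algC subC Cfm) (fc m) ig.
rewrite -mulN1r -RintegralZl//.
by apply: eq_Rintegral => x _; rewrite mulNr mulN1r.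
Qed.

(** * Essential boundedness in terms of a.e. bounds *)

Section essentially_bounded.
Context {d : measure_display} {X : measurableType d} {R : realType}.
Variable mu : {measure set X -> \bar R}.
Hypothesis mu0 : (0 < mu setT)%E.

Lemma LinftyP (F : X -> R) : Linfty mu F <->
  measurable_fun setT F /\ exists c, {ae mu, forall x, `|F x| <= c}.
Proof.
split.
  rewrite /Linfty /= inE => /andP[]; rewrite !inE /= => mF.
  rewrite /finite_norm unlock mu0 => Fy; split => //.
  have := ess_sup_ge mu (abse \o (EFin \o F)).
  case: (ess_sup _ _) Fy => // [c|] _ Fc.
    by exists c; apply: filterS Fc => x; rewrite /= lee_fin.
  (* An essential supremum [-oo] would make [|F x|] equal to [-oo] a.e., from which any bound
     follows. *)
  by exists 0; apply: filterS Fc => x; rewrite leeNy_eq.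
move=> [mF [c Fc]]; rewrite /Linfty /= inE; apply/andP; rewrite !inE; split => //.
rewrite /= /finite_norm unlock mu0; apply: (@le_lt_trans _ _ c%:E); last exact: ltry.
by apply/ess_supP; apply: filterS Fc => x; rewrite /= lee_fin.
Qed.

Lemma Lnorm_infty_lt (F : X -> R) (e : R) :
  ('N[mu]_+oo[EFin \o F] < e%:E)%E -> {ae mu, forall x, `|F x| <= e}.
Proof.
rewrite unlock mu0 => /ltW /ess_supP; apply: filterS => x.
by rewrite /= lee_fin.
Qed.

End essentially_bounded.

(** Truncation turns an a.e. bound into the pointwise bound required by [tail_mixing_cvg], without
    losing measurability for a sub-sigma-algebra. *)
Definition clamp {R : realType} (c x : R) := Num.max (- c) (Num.min c x).

Lemma normr_clamp {R : realType} (c x : R) : 0 <= c -> `|clamp c x| <= c.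
Proof.
move=> c0; rewrite ler_norml /clamp le_max lexx /= ge_max ge_min lexx andbT.
by rewrite (le_trans _ c0)// oppr_le0.
Qed.

Lemma clamp_id {R : realType} (c x : R) : `|x| <= c -> clamp c x = x.
Proof. by rewrite ler_norml /clamp => /andP[cx xc]; rewrite min_r// max_r. Qed.

Lemma measurable_clamp {R : realType} (c : R) : measurable_fun setT (clamp c).
Proof. by apply: measurable_maxr => //; exact: measurable_minr. Qed.

(** * Iterates of a measure-preserving map *)

Section invariance.
Context {d : measure_display} {X : measurableType d} {R : realType}.
Variables (mu : {measure set X -> \bar R}) (T : X -> X).
Hypothesis mpT : measure_preserving mu T.

Lemma measure_preserving_iter n : measure_preserving mu (iter n T).
Proof.
have [mT muT] := mpT.
elim: n => [|n [mTn muTn]]; first by split => //; exact: measurable_id.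
split; first exact: measurableT_comp.
move=> A mA; rewrite -(muT _ mA) -(muTn (T @^-1` A))//.
by rewrite -[X in measurable X]setTI; exact: mT.
Qed.

Lemma ae_iter n (P : X -> Prop) :
  {ae mu, forall x, P x} -> {ae mu, forall x, P (iter n T x)}.
Proof.
have [mTn muTn] := measure_preserving_iter n.
move=> [N [mN N0 PN]]; exists (iter n T @^-1` N); split.
- by rewrite -[X in measurable X]setTI; exact: mTn.
- by rewrite muTn.
- by move=> x Px; exact: PN.
Qed.

Lemma integral_iter n (f : X -> R) : mu.-integrable setT (EFin \o f) ->
  mu.-integrable setT (EFin \o (fun x => f (iter n T x))) /\
  \int[mu]_x `|f (iter n T x)| = \int[mu]_x `|f x|.
Proof.
have [mTn muTn] := measure_preserving_iter n => intf.
have mf : measurable_fun setT f by exact/measurable_EFinP/(measurable_int _ intf).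
have E : (\int[mu]_x `|f (iter n T x)|%:E = \int[mu]_x `|f x|%:E)%E.
  rewrite -(@ge0_integral_pushforward _ _ _ _ _ _ mTn mu setT
    (fun y => `|f y|%:E)) ?preimage_setT//; last first.
    by apply/measurable_EFinP; exact: measurableT_comp.
  apply: eq_measure_integral => A mA _; exact: muTn.
split; last by rewrite /Rintegral E.
move/integrableP : intf => [_ fy]; apply/integrableP; split.
  by apply/measurable_EFinP; exact: measurableT_comp.
by move: fy; rewrite /= -E.
Qed.
End invariance.

(** * Decay along the tower [T^-n B], common to exact and K-systems *)

Section factor.
Context {d : measure_display} {X : measurableType d} {R : realType}.
Variables (mu : {measure set X -> \bar R}) (T : X -> X) (B : set (set X)).
Hypothesis mpT : measure_preserving mu T.
Hypothesis algB : sigma_algebra setT B.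
Hypothesis subB : B `<=` measurable.
Hypothesis stableB : forall A, B A -> B (T @^-1` A).
Hypothesis tailB : eq_mod mu (\bigcap_n preimages T n B) (null_sigma_algebra mu).

Lemma sigma_algebra_preimages n : sigma_algebra setT (preimages T n B).
Proof.
have := @sigma_algebra_preimage X X B setT (iter n T) algB.
congr (sigma_algebra setT _); apply/seteqP.
by split => _ [A BA <-]; exists A; rewrite ?setTI.
Qed.

Lemma sub_preimages n : preimages T n B `<=` measurable.
Proof.
move=> _ [A /subB mA <-]; have [mTn _] := measure_preserving_iter mpT n.
by rewrite -[X in measurable X]setTI; exact: mTn.
Qed.

Lemma decr_preimages n : preimages T n.+1 B `<=` preimages T n B.
Proof. by move=> _ [A BA <-]; exists (T @^-1` A) => //; exact: stableB. Qed.

(** Triviality is given modulo [mu] only, but [A] lies in the union of [A'] and the null set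
    [A + A'] (symmetric difference), and likewise for the complements. *)
Lemma tail_preimages A : (forall n, preimages T n B A) ->
  mu A = 0%E \/ mu (~` A) = 0%E.
Proof.
move=> tA; have [A' [mA' nullA'] AA'] := tailB.1 A (fun n _ => tA n).
have mA : measurable A by exact: (@sub_preimages 0).
have mAA' : measurable (A `+` A').
  by apply: measurableU; exact: measurableD.
case: nullA' => N; [left|right].
  apply: (subset_measure0 mA (measurableU _ _ mA' mAA')); last first.
    exact: null_set_setU.
  move=> x Ax; have [?|?] := pselect (A' x); first by left.
  by right; left.
apply: (subset_measure0 (measurableC mA) (measurableU _ _ (measurableC mA') mAA')).
  move=> x Ax; have [?|?] := pselect (A' x); last by left.
  by right; right.
by apply: null_set_setU => //; exact: measurableC.
Qed.

(** If [F' o T^m] is [B]-measurable, then [F' o T^(n+m)] is measurable for [T^-n B], so it decays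
    against [g]; the error [F - F'] is bounded by [e] at all times, by invariance of [mu]. *)
Lemma GLM1_factor (F g : X -> R) :
  measurable_fun setT F ->
  (forall e : R, 0 < e -> exists (m : nat) (F' : X -> R) (c : R),
    [/\ forall Y, measurable Y -> B (iter m T @^-1` (F' @^-1` Y)),
        forall x, `|F' x| <= c & {ae mu, forall x, `|F x - F' x| <= e}]) ->
  mu.-integrable setT (EFin \o g) -> \int[mu]_x g x = 0 ->
  (\int[mu]_x (F (iter n T x) * g x)) @[n --> \oo] --> (0 : R).
Proof.
move=> mF approxF ig g0; apply/cvgrPdist_lt => e e0.
have G0 : 0 <= \int[mu]_x `|g x| by exact: Rintegral_ge0.
(* Makes [e'] times the integral of [|g|] at most [e / 2]; the [1] keeps the denominator
   positive. *)
pose e' := e / 2 / (1 + \int[mu]_x `|g x|).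
have e'0 : 0 < e' by rewrite !divr_gt0// ltr_pwDl.
have [m [F' [c [BF' F'c FF']]]] := approxF e' e'0.
have adF' n : adapted (fun n => preimages T n B) n (fun x => F' (iter (n + m) T x)).
  apply/(adaptedP sigma_algebra_preimages) => Y mY.
  exists (iter m T @^-1` (F' @^-1` Y)); first exact: BF'.
  by apply/seteqP; split => x /=; rewrite addnC iterD.
have /cvgrPdist_lt/(_ (e / 2)) := tail_mixing_cvg sigma_algebra_preimages
  sub_preimages decr_preimages tail_preimages adF' (fun n x => F'c _) ig g0.
have e20 : 0 < e / 2 by rewrite divr_gt0.
move=> /(_ e20) [N _ HN]; exists (N + m)%N => // n /= Nmn.
have mn : (m <= n)%N by rewrite (leq_trans _ Nmn)// leq_addl.
have := HN (n - m)%N; rewrite /= leq_subRL// addnC => /(_ Nmn).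
rewrite subnK// !sub0r !normrN => F'lt.
have mF'n : measurable_fun setT (fun x => F' (iter n T x)).
  have := adapted_measurable sigma_algebra_preimages sub_preimages (adF' (n - m)%N).
  by rewrite subnK.
have [mTn _] := measure_preserving_iter mpT n.
have mFn : measurable_fun setT (fun x => F (iter n T x)) by exact: measurableT_comp.
have mD : measurable_fun setT (fun x => F (iter n T x) - F' (iter n T x)).
  exact: measurable_funB.
have Dle := ae_iter mpT n FF'.
have iD := integrable_ae_bounded_mul mD Dle ig.
have iF' := integrable_bounded_mul mF'n (fun x => F'c _) ig.
have -> : \int[mu]_x (F (iter n T x) * g x) =
    \int[mu]_x ((F (iter n T x) - F' (iter n T x)) * g x) +
    \int[mu]_x (F' (iter n T x) * g x).
  by rewrite -RintegralD//; apply: eq_Rintegral => x _; ring.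
rewrite (le_lt_trans (ler_normD _ _))// [ltRHS]splitr ler_ltD//.
have := normr_Rintegral_ae_bounded_mul (ltW e'0) mD Dle ig.
move=> /le_trans; apply; rewrite /e' -[leLHS]mulrA ler_piMr ?(ltW e20)//.
by rewrite mulrC ler_pdivrMr ?mul1r ?ltr_pwDl// lerDr.
Qed.

End factor.

(** * Infinite-volume limits and averages *)

Section infinite_volume.
Context {d : measure_display} {X : measurableType d} {R : realType}.
Variables (mu : {measure set X -> \bar R}) (VV : set (set X)).
Hypothesis muT : mu setT = +oo%E.
Hypothesis exVV : exhaustive mu VV.

(** Continuity from below along the exhausting sequence, whose union has infinite measure. *)
Lemma exhaustive_large (M : R) : exists2 V, VV V & (M%:E <= mu V)%E.
Proof.
have [VVfin [V_ [VV_ ndV UV]]] := exVV.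
have : mu (V_ n) @[n --> \oo] --> mu (\bigcup_n V_ n).
  apply: (@nondecreasing_cvg_mu _ _ _ mu V_).
  - by move=> n; have [] := VVfin _ (VV_ n).
  - by rewrite UV.
  - by move=> m n mn; apply/subsetPset; exact: ndV.
rewrite UV muT => /cvgeyPge/(_ M) [n _ /(_ n (leqnn n))].
by exists (V_ n).
Qed.

Lemma volume_time_limP phi (l : R) : volume_time_lim mu VV phi l ->
  forall e : R, 0 < e -> \forall M \near +oo%R, forall V n,
    VV V -> (M%:E <= mu V)%E -> M <= n%:R -> `|phi V n - l| < e.
Proof.
move=> /fine_cvgP[fins /cvgr_lt lim] e e0.
have lime := lim e e0; apply: filterS2 fins lime => M finM ltM V n VVV MV Mn.
rewrite -lte_fin; apply: (@le_lt_trans _ _ (ereal_sup [set `|phi V n - l|%:E |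
      V in [set V | VV V /\ (M%:E <= mu V)%E] & n in [set n | M <= n%:R]])).
  by apply: ereal_sup_ubound; exists V => //; exists n.
by rewrite -[ltLHS]fineK// lte_fin.
Qed.

Lemma volume_limP phi (l : R) : volume_lim mu VV phi l ->
  forall e : R, 0 < e -> \forall M \near +oo%R, forall V,
    VV V -> (M%:E <= mu V)%E -> `|phi V - l| < e.
Proof.
move=> /fine_cvgP[fins /cvgr_lt lim] e e0.
have lime := lim e e0; apply: filterS2 fins lime => M finM ltM V VVV MV.
rewrite -lte_fin; apply: (@le_lt_trans _ _ (ereal_sup
    [set `|phi V - l|%:E | V in [set V | VV V /\ (M%:E <= mu V)%E]])).
  by apply: ereal_sup_ubound; exists V.
by rewrite -[ltLHS]fineK// lte_fin.
Qed.

Lemma measure_volume V : VV V -> mu V = (fine (mu V))%:E.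
Proof. by move=> /exVV.1[_ Vfin]; rewrite fineK// ge0_fin_numE. Qed.

(** [get] returns some limit; since the mean of 1 is exactly 1 on every set of positive measure, and
    arbitrarily large sets exist, that limit can only be 1. *)
Lemma average_cst1 : has_average mu VV (cst 1) -> average mu VV (cst 1) = 1.
Proof.
move=> /(@getPex _ [set l : R | volume_lim mu VV (mean mu ^~ (cst 1)) l]).
rewrite -/(average mu VV (cst 1)) => lim.
apply/eqP; rewrite -subr_eq0 -normr_le0; apply/ler_addgt0Pr => e e0; rewrite add0r.
have [M [M0 HM]] : exists M : R, 0 < M /\ forall V, VV V -> (M%:E <= mu V)%E ->
    `|mean mu V (cst 1) - average mu VV (cst 1)| < e.
  apply: (@filter_ex _ (pinfty_nbhs R)).
  by apply: filterS2 (nbhs_pinfty_gt (num_real 0)) (volume_limP lim e0).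
have [V VVV MV] := exhaustive_large M.
have [mV _] := exVV.1 _ VVV.
have MltV : M <= fine (mu V) by rewrite -lee_fin -measure_volume.
have := HM V VVV MV; rewrite /mean Rintegral_cst// mul1r mulVf; last first.
  by rewrite gt_eqF// (lt_le_trans M0).
by rewrite distrC => /ltW.
Qed.
End infinite_volume.

(** The sequence [b] may depend on [e]: it will be the integral of [g] times the mean of [F o T^n]
    over a set [V] chosen in terms of [e]. *)
Lemma cvg_approx {R : realType} (a : nat -> R) (l : R) :
  (forall e : R, 0 < e -> exists b : nat -> R,
    (a n - b n) @[n --> \oo] --> (0 : R) /\ \forall n \near \oo, `|b n - l| <= e) ->
  a n @[n --> \oo] --> l.
Proof.
move=> H; apply/cvgrPdist_lt => e e0; have e20 : 0 < e / 2 by rewrite divr_gt0.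
have [b [/cvgrPdist_lt/(_ _ e20) ab bl]] := H _ e20.
apply: filterS2 ab bl => n; rewrite sub0r normrN => abn bln.
have -> : l - a n = - (b n - l) - (a n - b n) by ring.
by rewrite (le_lt_trans (ler_normB _ _))// normrN [ltRHS]splitr ler_ltD.
Qed.

(** * Consequences of (GLM1) *)

Section mixing.
Context {d : measure_display} {X : measurableType d} {R : realType}.
Variables (mu : {measure set X -> \bar R}) (T : X -> X) (VV : set (set X))
  (GG : set (X -> R)).
Hypothesis muX : mu setT = +oo%E.
Hypothesis mpT : measure_preserving mu T.
Hypothesis exVV : exhaustive mu VV.
Hypothesis GGb : GG `<=` Linfty mu.
Hypothesis GLM1_GG : GLM1 mu T GG (L1 mu).

Lemma L1P (g : X -> R) : L1 mu g <-> mu.-integrable setT (EFin \o g).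
Proof. exact: Lfun1_integrable. Qed.

Lemma integrable_observable F g n : GG F -> L1 mu g ->
  mu.-integrable setT (EFin \o (fun x => F (iter n T x) * g x)).
Proof.
have mu0 : (0 < mu setT)%E by rewrite muX.
move=> /GGb /(LinftyP mu0)[mF [c Fc]] /L1P; apply: integrable_ae_bounded_mul.
  by have [mTn _] := measure_preserving_iter mpT n; exact: measurableT_comp.
exact: (@ae_iter _ _ _ _ _ mpT n (fun x => `|F x| <= c)).
Qed.

(** (GLM1) applies to [g - r g'], whose integral is zero. *)
Lemma GLM1_compare F g g' (r : R) : GG F -> L1 mu g -> L1 mu g' ->
  \int[mu]_x g x = r * \int[mu]_x g' x ->
  (\int[mu]_x (F (iter n T x) * g x) - r * \int[mu]_x (F (iter n T x) * g' x))
    @[n --> \oo] --> (0 : R).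
Proof.
move=> GF Lg Lg' gg'; have [/L1P ig /L1P ig'] := (Lg, Lg').
have irg' := integrableZl measurableT r ig'.
have Lh : L1 mu (fun x => g x - r * g' x).
  apply/L1P; exact: (integrableB measurableT ig irg').
have h0 : \int[mu]_x (g x - r * g' x) = 0.
  by rewrite RintegralB// RintegralZl// gg' subrr.
apply: cvg_trans (GLM1_GG GF Lh h0); apply: near_eq_cvg; apply: nearW => n.
have iF := integrable_observable n GF Lg; have iF' := integrable_observable n GF Lg'.
rewrite -RintegralZl// -RintegralB//; last first.
  exact: (integrableZl measurableT r iF').
by apply: eq_Rintegral => x _; ring.
Qed.

Lemma Rintegral_indic_mul V (F : X -> R) : measurable V ->
  \int[mu]_x (F x * \1_V x) = \int[mu]_(x in V) F x.
Proof.
move=> mV; rewrite [RHS]Rintegral_mkcond; apply: eq_Rintegral => x _.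
by rewrite patchE indicE; case: (x \in V); rewrite ?mulr1 ?mulr0.
Qed.

Lemma L1_indic V : VV V -> L1 mu \1_V.
Proof.
move=> /exVV.1[mV Vfin]; apply/L1P; apply/integrableP; split.
  exact/measurable_EFinP.
rewrite (_ : (\int[mu]_x `|(EFin \o \1_V) x|)%E = mu V)//.
under eq_integral do rewrite /= ger0_norm//.
by rewrite integral_indic// setIT.
Qed.

Lemma GLM1_mean F g V : GG F -> L1 mu g -> VV V -> 0 < fine (mu V) ->
  (\int[mu]_x (F (iter n T x) * g x) -
     \int[mu]_x g x * mean mu V (fun x => F (iter n T x)))
    @[n --> \oo] --> (0 : R).
Proof.
move=> GF Lg VVV V0; have [mV Vfin] := exVV.1 _ VVV.
have /(GLM1_compare GF Lg (L1_indic VVV)) : \int[mu]_x g x =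
    \int[mu]_x g x / fine (mu V) * \int[mu]_x \1_V x.
  have -> : \int[mu]_x (\1_V x : R) = fine (mu V).
    by rewrite /Rintegral integral_indic// setIT.
  by rewrite divfK// gt_eqF.
apply: cvg_trans; apply: near_eq_cvg; apply: nearW => n.
by rewrite Rintegral_indic_mul// /mean mulrA.
Qed.

(** Invariance makes the bound uniform in [n]; it vanishes as [V] grows. *)
Lemma normr_mean_iter V (f : X -> R) n : VV V -> L1 mu f ->
  `|mean mu V (fun x => f (iter n T x))| <= (fine (mu V))^-1 * \int[mu]_x `|f x|.
Proof.
move=> /exVV.1[mV _] /L1P /(integral_iter mpT n)[ifn <-].
rewrite /mean normrM ger0_norm ?invr_ge0// ler_wpM2l ?invr_ge0//.
rewrite -Rintegral_indic_mul// -[leRHS]mul1r.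
under eq_Rintegral do rewrite mulrC.
apply: normr_Rintegral_ae_bounded_mul => //.
by apply: aeW => x; rewrite indicE; case: (x \in V); rewrite ?normr1 ?normr0.
Qed.

Lemma LLM_of_GLM1 : LLM mu T GG (L1 mu).
Proof.
move=> f g Lf Gf Lg; apply: cvg_approx => e e0.
(* For [mu V >= M], the product of the two integrals divided by [mu V] is at most [e]; the [1] makes
   [M] positive. *)
pose M := 1 + `|\int[mu]_x g x| * \int[mu]_x `|f x| / e.
have M0 : 0 < M.
  by rewrite ltr_pwDl// divr_ge0 ?(ltW e0)// mulr_ge0// Rintegral_ge0.
have [V VVV] := exhaustive_large muX exVV M.
rewrite (measure_volume exVV VVV) lee_fin => MV.
have V0 := lt_le_trans M0 MV.
eexists; split; first exact: GLM1_mean Gf Lg VVV V0.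
apply: nearW => n; rewrite subr0 normrM.
rewrite (le_trans (ler_wpM2l _ (normr_mean_iter n VVV Lf)))//.
rewrite mulrCA mulrC ler_pdivrMr// -ler_pdivrMl// mulrC.
by rewrite (le_trans _ MV)// lerDr.
Qed.

Lemma GLM2_of_GGM2 : GG (cst 1) -> (forall F, GG F -> has_average mu VV F) ->
  GGM2 mu T VV GG -> GLM2 mu T VV GG (L1 mu).
Proof.
move=> G1 av ggm2 F g GF Lg; apply: cvg_approx => e e0.
pose e' := e / (1 + `|\int[mu]_x g x|).
have e'0 : 0 < e' by rewrite divr_gt0// ltr_pwDl.
(* (GGM2) with [G = 1]. The joint limit allows one [V] to be fixed while [n] still runs over all
   large times. *)
have [M [M0 HM]] : exists M : R, 0 < M /\ forall V n, VV V -> (M%:E <= mu V)%E ->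
    M <= n%:R -> `|mean mu V (fun x => F (iter n T x)) - average mu VV F| < e'.
  apply: (@filter_ex _ (pinfty_nbhs R)).
  have := volume_time_limP (ggm2 _ _ GF G1) e'0.
  apply: filterS2 (nbhs_pinfty_gt (num_real 0)) => M M0 HM; split => // V n VVV MV Mn.
  have := HM V n VVV MV Mn; rewrite (average_cst1 muX exVV (av _ G1)) mulr1.
  by under eq_fun do rewrite mulr1.
have [V VVV MV] := exhaustive_large muX exVV M.
have V0 : 0 < fine (mu V).
  by rewrite (lt_le_trans M0)// -lee_fin -(measure_volume exVV VVV).
eexists; split; first exact: GLM1_mean GF Lg VVV V0.
near=> n; rewrite [average _ _ _ * _]mulrC -mulrBr normrM.
have Mn : M <= n%:R by near: n; exact: nbhs_infty_ger.
rewrite (le_trans (ler_wpM2l _ (ltW (HM V n VVV MV Mn))))//.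
by rewrite /e' mulrCA ler_piMr ?(ltW e0)// ler_pdivrMr ?mul1r ?ltr_pwDl// lerDr.
Unshelve. all: by end_near. Qed.

Lemma GLM2_of_GLM2_at :
  (forall F, GG F -> exists gF, [/\ L1 mu gF, \int[mu]_x gF x != 0 &
    GLM2_at mu T VV F gF]) -> GLM2 mu T VV GG (L1 mu).
Proof.
move=> H F g GF Lg; have [g' [Lg' g'0 Fg']] := H F GF.
pose r := \int[mu]_x g x / \int[mu]_x g' x.
have rg' : \int[mu]_x g x = r * \int[mu]_x g' x by rewrite divfK.
rewrite /GLM2_at rg' mulrCA -[X in _ --> X]add0r.
under eq_fun => n do
  rewrite -(subrK (r * \int[mu]_x (F (iter n T x) * g' x)) (\int[mu]_x _)).
apply: cvgD; first exact: GLM1_compare GF Lg Lg' rg'.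
by apply: cvgM; [exact: cvg_cst|exact: Fg'].
Qed.
End mixing.

(** * The exact case and the K case *)

Section observables.
Context {d : measure_display} {X : measurableType d} {R : realType}.
Variables (mu : {measure set X -> \bar R}) (T : X -> X).
Hypothesis mu0 : (0 < mu setT)%E.
Hypothesis mpT : measure_preserving mu T.

Lemma clamp_approx (F G : X -> R) (c e : R) :
  {ae mu, forall x, `|F x - G x| <= e} -> {ae mu, forall x, `|G x| <= c} ->
  {ae mu, forall x, `|F x - clamp (Num.max c 0) (G x)| <= e}.
Proof.
move=> FG Gc; apply: filterS2 FG Gc => x FGx Gxc.
by rewrite clamp_id// (le_trans Gxc)// le_max lexx.
Qed.

Lemma Linfty_cst (r : R) : Linfty mu (cst r).
Proof.
apply/(LinftyP mu0); split; first exact: measurable_cst.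
by exists `|r|; apply: aeW => x.
Qed.

Lemma GLM1_exact : exact_system mu T -> GLM1 mu T (Linfty mu) (L1 mu).
Proof.
move=> exactT F g /(LinftyP mu0)[mF [c Fc]] /L1P ig g0.
have [mT _] := mpT.
apply: (GLM1_factor mpT _ _ _ exactT) => //.
- split; first exact: measurable0.
    by move=> A mA; rewrite setTD; exact: measurableC.
  exact: bigcupT_measurable.
- by move=> A mA; rewrite -[X in measurable X]setTI; exact: mT.
(* Truncation changes [F] on a null set only; the maximum with 0 makes the level nonnegative. *)
move=> e e0; exists 0%N, (fun x => clamp (Num.max c 0) (F x)), (Num.max c 0).
have c0 : 0 <= Num.max c 0 by rewrite le_max lexx orbT.
split.
- move=> Y mY; rewrite -[X in measurable X]setTI.
  have mcF : measurable_fun setT (clamp (Num.max c 0) \o F).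
    by apply: measurableT_comp => //; exact: measurable_clamp.
  exact: (mcF measurableT Y mY).
- by move=> x; exact: normr_clamp.
by apply: clamp_approx Fc; apply: aeW => x; rewrite subrr normr0 ltW.
Qed.

Variable S : X -> X.
Hypotheses (TS : cancel T S) (ST : cancel S T).

Lemma preimage_image_iter n (A : set X) : iter n T @^-1` (iter n T @` A) = A.
Proof.
have injn : injective (iter n T).
  by elim: n => [|n IH] // u v /= /(can_inj TS) /IH.
apply/seteqP; split=> [x [y Ay /injn <-] //|x Ax].
by exists x.
Qed.

(** Makes [G = 1] available in (GGM2). Preimages under a constant are empty or full, and [T] maps
    the full space onto itself. *)
Lemma K_observables_cst B (r : R) : K_property mu T B -> K_observables mu T B (cst r).
Proof.
move=> [[algB _ _] _]; split; first exact: Linfty_cst.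
move=> e e0; exists (cst r).
  exists 1%N => //; split; first exact: Linfty_cst.
  have [B0 BD _] := algB.
  have BT : B setT by rewrite -(setD0 setT); exact: BD.
  move=> Y mY; rewrite preimage_cst; case: ifPn => _.
    by exists setT => //; apply/seteqP; split => // x _; exists (S x) => //=.
  by exists set0 => //; rewrite image_set0.
rewrite unlock mu0; apply: (@le_lt_trans _ _ 0%E); last by rewrite lte_fin.
by apply/ess_supP; apply: aeW => x; rewrite /= subrr normr0.
Qed.

(** As [T] is injective, [B] inside [T B] means that [T^-1] maps [B] into itself, and [G o T^m] is
    [B]-measurable when [G] is measurable for [T^m B]. *)
Lemma GLM1_K B : K_property mu T B -> GLM1 mu T (K_observables mu T B) (L1 mu).
Proof.
move=> [[algB subB BTB] [_ tailB]] F g [/(LinftyP mu0)[mF _] approxF] /L1P ig g0.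
apply: (GLM1_factor mpT algB subB _ tailB) => //.
  by move=> A /BTB[A' BA' <-]; rewrite (preimage_image_iter 1).
move=> e e0; have [G [m _ [/(LinftyP mu0)[mG [c Gc]] BG]]] := approxF e e0.
move=> /(Lnorm_infty_lt mu0) FG.
have c0 : 0 <= Num.max c 0 by rewrite le_max lexx orbT.
exists m, (fun x => clamp (Num.max c 0) (G x)), (Num.max c 0); split.
- move=> Y mY; have mcY : measurable (clamp (Num.max c 0) @^-1` Y).
    by rewrite -[X in measurable X]setTI; exact: measurable_clamp.
  have [A BA AG] := BG _ mcY.
  by rewrite comp_preimage -AG preimage_image_iter.
- by move=> x; exact: normr_clamp.
exact: clamp_approx FG Gc.
Qed.

End observables.

Theorem theorem3p5 (R : realType) (d : measure_display) (X : measurableType d)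
    (mu : {sigma_finite_measure set X -> \bar R}) (T : X -> X)
    (VV : set (set X)) (GG LL : set (X -> R)) :
  mu setT = +oo%E ->
  measure_preserving mu T -> set_surj setT setT T ->
  exhaustive mu VV ->
  exact_case mu T VV GG LL \/ K_case mu T VV GG LL ->
  [/\ GLM1 mu T GG LL,
      LLM mu T GG LL &
      (forall F, GG F -> has_average mu VV F) ->
      (GGM2 mu T VV GG -> GLM2 mu T VV GG LL) /\
      ((forall F, GG F -> exists gF, [/\ LL gF, \int[mu]_x gF x != 0 &
          GLM2_at mu T VV F gF]) ->
       GLM2 mu T VV GG LL)].
Proof.
move=> muX mpT _ exVV cases.
have mu0 : (0 < mu setT)%E by rewrite muX.
(* Beyond these four facts, the two cases need no separate treatment. *)
have [GGb GG1 glm1 ->] : [/\ GG `<=` Linfty mu, GG (cst 1),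
    GLM1 mu T GG (L1 mu) & LL = L1 mu].
  case: cases => [[exactT _ -> ->]|[[_ [S [TS ST _]]] [B [KB _ -> ->]]]].
    by split => //; [exact: Linfty_cst|exact: GLM1_exact].
  split => //; first by move=> F [].
    exact: (K_observables_cst mu0 ST).
  exact: (GLM1_K mu0 mpT TS).
split => //; first exact: (LLM_of_GLM1 muX mpT exVV GGb).
move=> av; split; first exact: (GLM2_of_GGM2 muX mpT exVV GGb).
exact: GLM2_of_GLM2_at muX mpT GGb glm1.
Qed.
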